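(* Let $k \geq 2$ be an integer and suppose that $q=p^n$ is a prime power ($p$ prime, $n \ge 1$) such that $q \equiv 1 \bmod 2k$. If $k \mid p-1$, then $\mathbb{F}_p^{\times} \leq (\mathbb{F}_q^{\times})^k$ if and only if $n \equiv 0 \bmod k$.
   Context: For a finite field $\mathbb{F}_q$, $(\mathbb{F}_q^{\times})^k=\{\alpha\in\mathbb{F}_q^\times \mid \alpha=\beta^k \text{ for some } \beta\in\mathbb{F}_q^\times\}$ is the subgroup of nonzero $k$-th powers in the multiplicative group $\mathbb{F}_q^\times$. If $q$ is a power of the prime $p$, then $\mathbb{F}_p$ is regarded as the prime subfield of $\mathbb{F}_q$, and $\le$ denotes the subgroup relation inside $\mathbb{F}_q^\times$. *)

(* Defs.v *)
From mathcomp Require Import all_boot all_order all_fingroup all_algebra all_field.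

Set Implicit Arguments.
Unset Strict Implicit.
Unset Printing Implicit Defensive.

Import GRing.Theory.

(* Since 0^-1 = 0, closure under division need not exclude y = 0. *)
Definition is_subfield (F : finFieldType) (K : {set F}) : bool :=
  [&& (1 \in K)%R,
      [forall x in K, forall y in K, (x - y \in K)%R]
    & [forall x in K, forall y in K, (x / y \in K)%R]].

Lemma is_subfieldP (F : finFieldType) (K : {set F}) :
  reflect (GRing.divring_closed K) (is_subfield K).
Proof.
apply: (iffP and3P) => -[K1 KB KV]; split=> //.
- by move=> x y Kx Ky; apply: (forall_inP (forall_inP KB x Kx)).
- by move=> x y Kx Ky; apply: (forall_inP (forall_inP KV x Kx)).
- by apply/forall_inP => x Kx; apply/forall_inP => y Ky; apply: KB.
- by apply/forall_inP => x Kx; apply/forall_inP => y Ky; apply: KV.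
Qed.

Definition prime_subfield (F : finFieldType) : {set F} :=
  \bigcap_(K : {set F} | is_subfield K) K.

Lemma prime_subfield_is_subfield (F : finFieldType) :
  is_subfield (prime_subfield F).
Proof.
apply/is_subfieldP; split.
- by apply/bigcapP => K /is_subfieldP[].
- move=> x y /bigcapP Px /bigcapP Py; apply/bigcapP => K sK.
  by case/is_subfieldP: (sK) => _ KB _; apply: KB; [apply: Px | apply: Py].
- move=> x y /bigcapP Px /bigcapP Py; apply/bigcapP => K sK.
  by case/is_subfieldP: (sK) => _ _ KV; apply: KV; [apply: Px | apply: Py].
Qed.

Definition prime_units (F : finFieldType) : {set {unit F}} :=
  [set u : {unit F} | val u \in prime_subfield F].

Lemma prime_units_group_set (F : finFieldType) : group_set (prime_units F).
Proof.
have /is_subfieldP[P1 _ PV] := prime_subfield_is_subfield F.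
apply/group_setP; split=> [|x y]; rewrite !inE //= => Px Py.
by rewrite -[X in (_ * X)%R]invrK; apply: (PV) => //; rewrite -div1r; apply: PV.
Qed.

Canonical prime_units_group (F : finFieldType) : {group {unit F}} :=
  Group (prime_units_group_set F).

Definition power_units (F : finFieldType) (k : nat) : {set {unit F}} :=
  [set (b ^+ k)%g | b : {unit F}].

Lemma power_units_group_set (F : finFieldType) (k : nat) :
  group_set (power_units F k).
Proof.
apply/group_setP; split=> [|_ _ /imsetP[x _ ->] /imsetP[y _ ->]]; apply/imsetP.
  by exists 1%g; rewrite // expg1n.
exists (x * y)%g; rewrite // expgMn //; apply: val_inj; exact: mulrC.
Qed.

Canonical power_units_group (F : finFieldType) (k : nat) : {group {unit F}} :=
  Group (power_units_group_set F k).

(* Main.v *)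
(** [F^*] is cyclic of order [q - 1], so its subgroups are ordered by
    divisibility of their orders. [F_p^*] has order [p - 1] and, since [k]
    divides [q - 1], the group of [k]-th powers has order [(q - 1) / k]. Hence
    the inclusion means [k %| (q - 1) / (p - 1) = 1 + p + ... + p ^ (n - 1)],
    and this sum is congruent to [n] modulo [k] because [p] is congruent to 1. *)
Require Import Defs.
From mathcomp Require Import all_boot all_order all_fingroup all_algebra all_field.
From mathcomp Require Import all_solvable.

Set Implicit Arguments.
Unset Strict Implicit.
Unset Printing Implicit Defensive.

Import GRing.Theory.

Lemma natr_prime_subfield (F : finFieldType) (i : nat) :
  (i%:R)%R \in prime_subfield F.
Proof.
have /is_subfieldP[P1 PB _] := prime_subfield_is_subfield F.
have P0 : 0%R \in prime_subfield F by rewrite -(subrr 1%R) PB.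
elim: i => // i IHi; rewrite -addn1 natrD -[X in (_ + X)%R]opprK PB //.
by rewrite -sub0r PB.
Qed.

Lemma rmorphism_image_subfield (K F : finFieldType) (f : {rmorphism K -> F}) :
  is_subfield (f @: [set: K]).
Proof.
apply/is_subfieldP; split=> [|_ _ /imsetP[x _ ->] /imsetP[y _ ->]
                            |_ _ /imsetP[x _ ->] /imsetP[y _ ->]].
- by rewrite -(rmorph1 f) imset_f.
- by rewrite -rmorphB imset_f.
- by rewrite -fmorph_div imset_f.
Qed.

(** The image of ['F_p] is a subfield, hence contains the intersection of all subfields. Conversely,
    each of its elements is a natural multiple of 1, and these lie in every subfield. *)
Lemma card_prime_subfield (F : finFieldType) (p : nat) :
  p \in [pchar F]%R -> #|prime_subfield F| = p.
Proof.
move=> chFp; have pr_p := pcharf_prime chFp.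
(* [pPrimeCharType chFp] is [F] itself, viewed as an algebra over ['F_p]; [f] sends a scalar to its
   multiple of 1. *)
pose f : {rmorphism 'F_p -> F} :=
  (in_alg (pPrimeCharType chFp) : {rmorphism 'F_p -> pPrimeCharType chFp}).
have -> : prime_subfield F = f @: [set: 'F_p].
  apply/eqP; rewrite eqEsubset bigcap_inf ?rmorphism_image_subfield //=.
  apply/subsetP => _ /imsetP[a _ ->].
  by rewrite -[a]natr_Zp rmorph_nat natr_prime_subfield.
by rewrite card_imset ?cardsT ?card_Fp //; apply: fmorph_inj.
Qed.

Lemma card_prime_units (F : finFieldType) (p : nat) :
  p \in [pchar F]%R -> #|prime_units F| = p - 1.
Proof.
move=> chFp; rewrite -(card_prime_subfield chFp).
(* Zero is the case [i = 0] of [natr_prime_subfield]; removing it accounts for the [- 1]. *)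
rewrite (cardsD1 0%R) (natr_prime_subfield F 0) addKn.
rewrite -(card_imset _ (@val_inj _ _ {unit F})); congr #|pred_of_set _|.
apply/setP => x; rewrite !inE; apply/imsetP/andP => [[u] | [x0 Px]].
  by rewrite inE => Pu ->; rewrite -unitfE (valP u).
have Ux : x \is a GRing.unit by rewrite unitfE.
by exists (FinRing.unit F Ux); rewrite ?inE.
Qed.

(** If [x] generates the unit group, the [k]-th powers are the cyclic group generated by [x ^+ k],
    of order [#[x] %/ k] since [k] divides [#[x]]. *)
Lemma card_power_units (F : finFieldType) (k : nat) :
  k %| #|F| - 1 -> #|power_units F k| = (#|F| - 1) %/ k.
Proof.
rewrite subn1 -card_finField_unit => kF.
have /cyclicP[x defU] := field_unit_group_cyclic [set: {unit F}]%G.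
have -> : power_units F k = <[x ^+ k]>%g.
  apply/setP => y; apply/imsetP/cycleP => [[b _ ->] | [i ->]].
    have /cycleP[i ->] : b \in <[x]>%g by rewrite -defU inE.
    by exists i; rewrite expgAC.
  by exists (x ^+ i)%g; rewrite // expgAC.
by rewrite -orderE orderXdiv orderE -defU.
Qed.

Lemma geometric_sum_mod1 (k p n : nat) :
  p = 1 %[mod k] -> \sum_(i < n) p ^ i = n %[mod k].
Proof.
(* Writing [n] as a sum of [n] ones allows a termwise comparison. *)
move=> p1; rewrite -[in RHS](card_ord n) -sum1_card.
elim/big_ind2: _ => // [a b c d ab cd | i _]; first by rewrite -modnDm ab cd modnDm.
by rewrite -modnXm p1 modnXm exp1n.
Qed.

Theorem corollary1p8 (k p n q : nat) (F : finFieldType)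
    (hk : 2 <= k) (hp : prime p) (hn : 1 <= n) (hq : q = p ^ n)
    (hF : #|F| = q) (hmod : q = 1 %[mod 2 * k]) (hkp : k %| p - 1) :
  (prime_units_group F \subset power_units_group F k) <-> n = 0 %[mod k].
Proof.
have chFp : p \in [pchar F]%R by apply: (@card_finPcharP _ _ n) => //; rewrite hF.
have p1 : p = 1 %[mod k] by apply/eqP; rewrite eqn_mod_dvd ?prime_gt0.
have p1_gt0 : 0 < p - 1 by rewrite subn_gt0 prime_gt1.
have defq1 : q - 1 = (p - 1) * \sum_(i < n) p ^ i.
  by rewrite hq !subn1 predn_exp.
have kq : k %| q - 1 by rewrite defq1 dvdn_mulr.
have cycU := field_unit_group_cyclic [set: {unit F}]%G.
rewrite -(cardSg_cyclic cycU) ?subsetT //=.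
rewrite (card_prime_units chFp) card_power_units hF //.
(* Moving [k] to the left gives [(p - 1) * k %| (p - 1) * \sum_(i < n) p ^ i], where the positive
   factor [p - 1] cancels. *)
rewrite dvdn_divRL // defq1 dvdn_pmul2l //.
rewrite /dvdn (geometric_sum_mod1 n p1) mod0n.
by split=> /eqP.
Qed.
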